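(* Let $h:\mathbb{R}^n\to\mathbb{R}$ and $\mathcal{S}=\{x\in\mathbb{R}^n\mid h(x)\ge 0\}$. Assume: (i) $\mathcal{S}$ is nonempty and compact; (ii) $h$ is continuously differentiable and $\nabla h$ is locally Lipschitz, with Lipschitz constant $L_{\nabla h}$ on $\mathcal{S}$; (iii) $\nabla h(x)\neq 0$ for all $x\in\mathbb{R}^n$ with $h(x)=0$; (iv) there is $\gamma\in\mathcal{K}_\infty$ such that $d(x,\partial\mathcal{S})\le\gamma(h(x))$ for all $x\in\mathcal{S}$. Let $P\in\mathbb{R}^{n\times n}$ be symmetric positive definite with minimum and maximum eigenvalues $\underline\lambda(P)$, $\overline\lambda(P)$, let $f:\mathbb{R}^m\times\mathbb{R}^n\to\mathbb{R}^n$ be locally Lipschitz, let $\mathcal{Z}\subset\mathbb{R}^m$ be compact, and let $L_f$ be the Lipschitz constant of $f$ on $\mathcal{Z}\times\mathcal{S}$. For $\epsilon$ with $0<\epsilon<\min_{y\in\partial\mathcal{S}}\|\nabla h(y)\|$, define $$\alpha_*=\frac{\max_{(z,x)\in\mathcal{Z}\times\mathcal{S}}|\mathcal{L}_fh(z,x)|}{\gamma^{-1}\Big(\frac{\min_{y\in\partial\mathcal{S}}\|\nabla h(y)\|-\epsilon}{L_{\nabla h}}\Big)},\quad M_1=\min_{x\in\partial\mathcal{S}}\|\nabla h(x)\|,\quad M_2=\max_{x\in\partial\mathcal{S}}\|\nabla h(x)\|,$$ $$M_3=M_2+L_{\nabla h}\,\gamma\Big(\tfrac{1}{\alpha_*}\max_{(z,x)\in\mathcal{Z}\times\mathcal{S}}|\mathcal{L}_fh(z,x)|\Big),\quad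 L_1=\frac{\overline\lambda(P)}{\underline\lambda(P)\epsilon^2}L_{\nabla h}\Big[1+\frac{M_2\overline\lambda(P)(M_2+M_3)}{\underline\lambda(P)M_1^2}\Big],$$ $$\sigma(\alpha)=\max_{(z,x)\in\mathcal{Z}\times\mathcal{S}}\max\Big\{\gamma\big(\tfrac1\alpha|\mathcal{L}_fh(z,x)|\big),\ \big(L_f+L_1|\mathcal{L}_fh(z,x)|\big)\gamma\big(\tfrac1\alpha|\mathcal{L}_fh(z,x)|\big)\Big\},$$ $$\delta=\max_{(z,x)\in\mathcal{Z}\times\mathcal{S}}\Big(1+\frac{L_{\nabla h}\gamma\big(\tfrac1{\alpha_*}|\mathcal{L}_fh(z,x)|\big)}{M_1}\Big)\frac{\overline\lambda(P)}{\underline\lambda(P)}\|f(z,x)\|.$$ Then, for any $\alpha\ge\alpha_*$ with $\alpha>0$ and for all $(z,x)\in\mathcal{Z}\times\mathcal{S}$, $$f^P_{\mathrm{cbf},\alpha}(z,x)\in\bigcup_{y\in(x+\sigma(\alpha)\mathbb{B})\cap\mathcal{S}}\Big(\mathrm{N}^P_{\mathcal{S}}\big(y,f(z,y),\delta\big)+\sigma(\alpha)\mathbb{B}\Big),$$ where $\mathrm{N}^P_{\mathcal{S}}(y,v,\delta)=v-\big(P^{-1}N_{\mathcal{S}}(y)\cap\delta\mathbb{B}\big)$ and $f^P_{\mathrm{cbf},\alpha}$ is the CBF-based vector field (see context).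
   Context: Notation: $\|\cdot\|$ is the Euclidean norm; $\|v\|_P=\sqrt{v^\top Pv}$; $\mathbb{B}$ is the closed unit ball; sums of sets are Minkowski sums; $d(x,A)=\min_{y\in A}\|x-y\|$ for closed $A$; $\partial\mathcal{S}$ is the topological boundary. $\mathcal{K}_\infty$ is the set of continuous strictly increasing $\gamma:[0,\infty)\to\mathbb{R}$ with $\gamma(0)=0$ and $\lim_{a\to\infty}\gamma(a)=+\infty$. $\mathcal{L}_fh(z,x):=\nabla h(x)^\top f(z,x)$. Normal cone: $N_{\mathcal{S}}(x)$ is the polar of the tangent cone to $\mathcal{S}$ at $x\in\mathcal{S}$; under the assumptions $N_{\mathcal{S}}(x)=\{0\}$ for $x$ in the interior of $\mathcal{S}$, and $N_{\mathcal{S}}(x)=\{\lambda\nabla h(x)\mid\lambda\le0\}$ for $x\in\partial\mathcal{S}$. CBF-based vector field with parameter $\alpha>0$: $f^P_{\mathrm{cbf},\alpha}(z,x)$ is the unique minimizer of $\|\mu-f(z,x)\|_P^2$ over $\mu\in\mathbb{R}^n$ subject to $\nabla h(x)^\top\mu+\alpha h(x)\ge0$; equivalently $$f^P_{\mathrm{cbf},\alpha}(z,x)=f(z,x)-\min\big(0,\mathcal{L}_fh(z,x)+\alpha h(x)\big)\frac{P^{-1}\nabla h(x)}{\|\nabla h(x)\|_{P^{-1}}^2}$$ (the correction term being $0$ when $x\in\mathcal{S}$ and $\nabla h(x)=0$). Convention: if $\alpha_*=0$ (i.e. $\mathcal{L}_fh\equiv0$ on $\mathcal{Z}\times\mathcal{S}$),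 expressions $\frac{1}{\alpha_*}|\mathcal{L}_fh|$ are read as $0$. *)

(* Defs.v *)
From HB Require Import structures.
From mathcomp Require Import all_boot all_order all_algebra.
From mathcomp Require Import all_classical all_reals all_analysis.
Set Implicit Arguments.
Unset Strict Implicit.
Unset Printing Implicit Defensive.
Import Order.TTheory GRing.Theory Num.Theory.
Import numFieldNormedType.Exports.
Local Open Scope classical_set_scope.
Local Open Scope ring_scope.

(* Vectors of R^n are column vectors.  The library's norm `|v| on matrices is
   the max norm: it is only used for topological notions (compactness,
   differentiability, local Lipschitz continuity), on which equivalent norms
   agree.  Every quantitative notion uses the Euclidean norm [enorm].
   Minima and maxima are written [inf] and [sup]; the sets involved are
   finite or continuous images of compact sets, so these are attained. *)

Definition dot (R : realType) (n : nat) (u v : 'cV[R]_n) : R :=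
  (u^T *m v) ord0 ord0.

Definition enorm (R : realType) (n : nat) (v : 'cV[R]_n) : R :=
  Num.sqrt (dot v v).

Definition pnorm (R : realType) (n : nat) (P : 'M[R]_n) (v : 'cV[R]_n) : R :=
  Num.sqrt (dot v (P *m v)).

Definition spd (R : realType) (n : nat) (P : 'M[R]_n) : Prop :=
  P^T = P /\ forall v : 'cV[R]_n, v != 0 -> 0 < dot v (P *m v).

Definition lambda_min (R : realType) (n : nat) (P : 'M[R]_n) : R :=
  inf [set a : R | eigenvalue P a].

Definition lambda_max (R : realType) (n : nat) (P : 'M[R]_n) : R :=
  sup [set a : R | eigenvalue P a].

Definition eucl_dist (R : realType) (n : nat) (x y : 'cV[R]_n) : R :=
  enorm (x - y).

(* Euclidean distance on R^m x R^n = R^(m + n) *)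
Definition eucl_dist_prod (R : realType) (m n : nat)
    (w w' : 'cV[R]_m * 'cV[R]_n) : R :=
  Num.sqrt (eucl_dist w.1 w'.1 ^+ 2 + eucl_dist w.2 w'.2 ^+ 2).

Definition dist_set (R : realType) (n : nat) (x : 'cV[R]_n)
    (A : set 'cV[R]_n) : R :=
  inf [set eucl_dist x y | y in A].

(* [L] is a Lipschitz constant of [F] on [A]; it need not be the least one. *)
Definition lipschitz_const (R : realType) (T : Type) (k : nat)
    (d : T -> T -> R) (A : set T) (F : T -> 'cV[R]_k) (L : R) : Prop :=
  forall u v, A u -> A v -> eucl_dist (F u) (F v) <= L * d u v.

Definition locally_lipschitz (R : realType) (V W : normedModType R)
    (F : V -> W) : Prop :=
  forall x : V, exists2 U, nbhs x U & [lipschitz F y | y in U].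

Definition grad (R : realType) (n : nat) (h : 'cV[R]_n -> R)
    (x : 'cV[R]_n) : 'cV[R]_n :=
  \col_i 'D_(delta_mx i ord0) h x.

Definition C1 (R : realType) (n : nat) (h : 'cV[R]_n -> R) : Prop :=
  (forall x, differentiable h x) /\ continuous (grad h).

Definition boundary (T : topologicalType) (A : set T) : set T :=
  closure A `\` interior A.

(* A function on [0, +oo[ is represented by a function on R whose values on
   negative reals are irrelevant. *)
Definition class_Kinfty (R : realType) (gamma : R -> R) : Prop :=
  [/\ {within `[0, +oo[, continuous gamma},
      {in `[0, +oo[ &, {homo gamma : a b / a < b}},
      gamma 0 = 0 &
      gamma a @[a --> +oo] --> +oo].

(* inverse of a class-K_infty function, a bijection of [0, +oo[ *)
Definition Kinv (R : realType) (gamma : R -> R) : R -> R :=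
  'pinv_(fun=> 0) (`[0, +oo[%classic : set R) gamma.

Definition unit_ball (R : realType) (n : nat) : set 'cV[R]_n :=
  [set v | enorm v <= 1].
Arguments unit_ball {R n}.

Definition scale_set (R : realType) (n : nat) (r : R) (A : set 'cV[R]_n) :
    set 'cV[R]_n :=
  [set r *: v | v in A].

Definition minkowski_sum (R : realType) (n : nat) (A B : set 'cV[R]_n) :
    set 'cV[R]_n :=
  [set u + v | u in A & v in B].

(* Bouligand tangent cone *)
Definition tangent_cone (R : realType) (n : nat) (S : set 'cV[R]_n)
    (x : 'cV[R]_n) : set 'cV[R]_n :=
  [set v | exists (t : nat -> R) (u : nat -> 'cV[R]_n),
    [/\ forall k, 0 < t k,
        t k @[k --> \oo] --> (0 : R),
        u k @[k --> \oo] --> v &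
        forall k, S (x + t k *: u k)]].

Definition polar (R : realType) (n : nat) (T : set 'cV[R]_n) :
    set 'cV[R]_n :=
  [set w | forall v, T v -> dot w v <= 0].

Definition normal_cone (R : realType) (n : nat) (S : set 'cV[R]_n)
    (x : 'cV[R]_n) : set 'cV[R]_n :=
  polar (tangent_cone S x).

(* N^P_S(y, v, delta) = v - (P^-1 N_S(y) `&` delta B) *)
Definition normal_coneP (R : realType) (n : nat) (P : 'M[R]_n)
    (S : set 'cV[R]_n) (y v : 'cV[R]_n) (delta : R) : set 'cV[R]_n :=
  [set v - w | w in [set invmx P *m eta | eta in normal_cone S y]
                    `&` scale_set delta unit_ball].

Definition lie (R : realType) (m n : nat)
    (f : 'cV[R]_m * 'cV[R]_n -> 'cV[R]_n) (h : 'cV[R]_n -> R)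
    (w : 'cV[R]_m * 'cV[R]_n) : R :=
  dot (grad h w.2) (f w).

Definition cbf_feasible (R : realType) (n : nat) (h : 'cV[R]_n -> R)
    (alpha : R) (x : 'cV[R]_n) : set 'cV[R]_n :=
  [set mu | 0 <= dot (grad h x) mu + alpha * h x].

(* The minimizer of mu |-> ||mu - f(z,x)||_P^2 on the feasible half-space.
   It exists and is unique when P is positive definite and the half-space is
   nonempty, in particular when 0 <= h x; the default value 0 of [xget] is
   only taken in the infeasible case. *)
Definition f_cbf (R : realType) (m n : nat) (P : 'M[R]_n)
    (f : 'cV[R]_m * 'cV[R]_n -> 'cV[R]_n) (h : 'cV[R]_n -> R) (alpha : R)
    (w : 'cV[R]_m * 'cV[R]_n) : 'cV[R]_n :=
  xget 0 [set mu | cbf_feasible h alpha w.2 mu /\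
    forall nu, cbf_feasible h alpha w.2 nu ->
      pnorm P (mu - f w) ^+ 2 <= pnorm P (nu - f w) ^+ 2].

(* Main.v *)
(** If the barrier constraint is inactive at [x], then [f_cbf] is [f (z, x)] and
    [y = x] works with the zero normal vector.  Otherwise
    [h x < `|Lfh| / alpha], so some boundary point [y] lies within
    [gamma (`|Lfh| / alpha)] of [x]; the choice of [alpha_s] makes this distance
    small enough that [eps <= enorm (grad h x)].  With
    [s := - (Lfh + alpha * h x)], which is in [0, `|Lfh|],
    [f_cbf P f h alpha (z, x) = f (z, x) + s *: cbf_dir P (grad h x)].  Moving
    the base point of both terms from [x] to [y] costs at most
    [(Lf + L1 * `|Lfh|) * enorm (x - y)], and [- s *: cbf_dir P (grad h y)] lies
    in [P^-1 N_S(y)] with norm at most [delta]. *)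

Require Import Defs.
From HB Require Import structures.
From mathcomp Require Import all_boot all_order all_algebra.
From mathcomp Require Import all_classical all_reals all_analysis.
From mathcomp Require Import ring lra.
Set Implicit Arguments.
Unset Strict Implicit.
Unset Printing Implicit Defensive.
Import Order.TTheory GRing.Theory Num.Theory.
Import numFieldNormedType.Exports.
Local Open Scope classical_set_scope.
Local Open Scope ring_scope.

(** * Euclidean inner product and norm *)

Lemma dotE (R : realType) n (u v : 'cV[R]_n) :
  dot u v = \sum_i u i ord0 * v i ord0.
Proof. by rewrite /dot mxE; apply: eq_bigr => i _; rewrite mxE. Qed.

Lemma dotC (R : realType) n (u v : 'cV[R]_n) : dot u v = dot v u.
Proof. by rewrite !dotE; apply: eq_bigr => i _; rewrite mulrC. Qed.

Lemma dotDr (R : realType) n (u v w : 'cV[R]_n) :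
  dot u (v + w) = dot u v + dot u w.
Proof. by rewrite /dot mulmxDr mxE. Qed.

Lemma dotZr (R : realType) n a (u v : 'cV[R]_n) : dot u (a *: v) = a * dot u v.
Proof. by rewrite /dot -scalemxAr mxE. Qed.

Lemma dotNr (R : realType) n (u v : 'cV[R]_n) : dot u (- v) = - dot u v.
Proof. by rewrite -scaleN1r dotZr mulN1r. Qed.

Lemma dotBr (R : realType) n (u v w : 'cV[R]_n) :
  dot u (v - w) = dot u v - dot u w.
Proof. by rewrite dotDr dotNr. Qed.

Lemma dotDl (R : realType) n (u v w : 'cV[R]_n) :
  dot (u + v) w = dot u w + dot v w.
Proof. by rewrite dotC dotDr !(dotC w). Qed.

Lemma dotZl (R : realType) n a (u v : 'cV[R]_n) : dot (a *: u) v = a * dot u v.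
Proof. by rewrite dotC dotZr dotC. Qed.

Lemma dotNl (R : realType) n (u v : 'cV[R]_n) : dot (- u) v = - dot u v.
Proof. by rewrite dotC dotNr dotC. Qed.

Definition dotS := (dotDr, dotDl, dotZr, dotZl, dotNr, dotNl).

Lemma dot_mulmx (R : realType) m n (A : 'M[R]_(m, n)) u v :
  dot u (A *m v) = dot (A^T *m u) v.
Proof. by rewrite /dot trmx_mul trmxK mulmxA. Qed.

Lemma dot0v (R : realType) n (v : 'cV[R]_n) : dot 0 v = 0.
Proof. by rewrite -(scale0r v) dotZl mul0r. Qed.

Lemma dot_ge0 (R : realType) n (v : 'cV[R]_n) : 0 <= dot v v.
Proof. by rewrite dotE; apply: sumr_ge0 => i _; rewrite -expr2 sqr_ge0. Qed.

Lemma dot_eq0 (R : realType) n (v : 'cV[R]_n) : (dot v v == 0) = (v == 0).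
Proof.
apply/eqP/eqP => [|->]; last exact: dot0v.
rewrite dotE => /eqP; rewrite psumr_eq0 => [/allP v0|i _]; last first.
  by rewrite -expr2 sqr_ge0.
apply/colP => i; rewrite mxE; apply/eqP.
by move: (v0 i (mem_index_enum i)); rewrite -expr2 sqrf_eq0.
Qed.

Lemma enorm_ge0 (R : realType) n (v : 'cV[R]_n) : 0 <= enorm v.
Proof. exact: sqrtr_ge0. Qed.

Lemma enorm_sqr (R : realType) n (v : 'cV[R]_n) : enorm v ^+ 2 = dot v v.
Proof. by rewrite sqr_sqrtr// dot_ge0. Qed.

Lemma enorm_eq0 (R : realType) n (v : 'cV[R]_n) : (enorm v == 0) = (v == 0).
Proof. by rewrite -sqrf_eq0 enorm_sqr dot_eq0. Qed.

Lemma enorm0 (R : realType) n : enorm (0 : 'cV[R]_n) = 0.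
Proof. by apply/eqP; rewrite enorm_eq0. Qed.

Lemma enormZ (R : realType) n a (v : 'cV[R]_n) :
  enorm (a *: v) = `|a| * enorm v.
Proof.
by rewrite /enorm !dotS mulrA -expr2 sqrtrM ?sqr_ge0// sqrtr_sqr.
Qed.

Lemma enormN (R : realType) n (v : 'cV[R]_n) : enorm (- v) = enorm v.
Proof. by rewrite -scaleN1r enormZ normrN1 mul1r. Qed.

(** * Cauchy-Schwarz and the triangle inequality *)

(** Nonnegativity of the form at all [s *: u + t *: v] gives the discriminant inequality. It is
    stated for semidefinite [B] because [rayleigh_max] applies it at an isotropic vector. *)
Lemma psd_CauchySchwarz (R : realType) n (B : 'M[R]_n) :
  B^T = B -> (forall v, 0 <= dot v (B *m v)) ->
  forall u v, dot u (B *m v) ^+ 2 <= dot u (B *m u) * dot v (B *m v).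
Proof.
move=> symB psdB u v.
set a := dot u (B *m u); set b := dot u (B *m v); set c := dot v (B *m v).
have bE : dot v (B *m u) = b by rewrite dot_mulmx symB dotC.
have quad s t : 0 <= s ^+ 2 * a + s * t * b *+ 2 + t ^+ 2 * c.
  have := psdB (s *: u + t *: v).
  rewrite mulmxDr -!scalemxAr !dotS -/a -/c -/b bE.
  by congr (0 <= _); ring.
have a0 : 0 <= a := psdB u.
have [a_eq0|a_neq0] := eqVneq a 0.
  have [->|b_neq0] := eqVneq b 0; first by rewrite a_eq0 mul0r expr0n.
  (* With [a = 0] the form at [s *: u + v] is affine in [s]; this [s] gives the value
     [- c - 2 < 0]. *)
  have := quad (- (c + 1) / b) 1; rewrite a_eq0 expr1n mulr0 add0r mulr1.
  by rewrite divfK//; have := psdB v; rewrite -/c; lra.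
have := quad (- b) a.
rewrite (_ : _ + _ = a * (a * c - b ^+ 2)); last by ring.
by rewrite pmulr_rge0 ?subr_ge0// lt0r a_neq0.
Qed.

Lemma CauchySchwarz (R : realType) n (u v : 'cV[R]_n) :
  `|dot u v| <= enorm u * enorm v.
Proof.
have := @psd_CauchySchwarz R n 1%:M (trmx1 _ _).
move=> /(_ _ u v); rewrite !mul1mx => CS.
rewrite -ler_sqr ?nnegrE ?mulr_ge0 ?enorm_ge0// real_normK ?num_real//.
by rewrite exprMn !enorm_sqr CS// => w; rewrite mul1mx dot_ge0.
Qed.

Lemma ler_enormD (R : realType) n (u v : 'cV[R]_n) :
  enorm (u + v) <= enorm u + enorm v.
Proof.
rewrite -ler_sqr ?nnegrE ?addr_ge0 ?enorm_ge0// sqrrD !enorm_sqr !dotS.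
have := CauchySchwarz u v; rewrite ler_norml => /andP[_].
by rewrite (dotC v); lra.
Qed.

Lemma ler_enormB (R : realType) n (u v : 'cV[R]_n) :
  enorm (u - v) <= enorm u + enorm v.
Proof. by rewrite -(enormN v) ler_enormD. Qed.

Lemma mem_scale_unit_ball (R : realType) n r (v : 'cV[R]_n) :
  enorm v <= r -> scale_set r unit_ball v.
Proof.
move=> vr; have r0 : 0 <= r := le_trans (enorm_ge0 v) vr.
have [r_eq0|r_neq0] := eqVneq r 0.
  exists 0; first by rewrite /unit_ball /= enorm0.
  by apply/esym/eqP; rewrite scaler0 -enorm_eq0 eq_le enorm_ge0 -r_eq0 vr.
exists (r^-1 *: v); last by rewrite scalerA divff// scale1r.
rewrite /unit_ball/= enormZ ger0_norm ?invr_ge0//.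
by rewrite ler_pdivrMl ?mulr1// lt0r r_neq0.
Qed.

(** * Continuity of matrix operations *)

Lemma continuous_sum (R : realType) (T : topologicalType) (I : Type)
    (r : seq I) (F : I -> T -> R) :
  (forall i, continuous (F i)) -> continuous (fun t => \sum_(i <- r) F i t).
Proof.
move=> cF; elim: r => [|i r IHr] t.
  rewrite (_ : (fun _ => _) = cst 0); first exact: cvg_cst.
  by apply/funext => s; rewrite big_nil.
rewrite (_ : (fun _ => _) = (fun s => F i s + \sum_(j <- r) F j s)).
  by apply: cvgD; [exact: cF|exact: IHr].
by apply/funext => s; rewrite big_cons.
Qed.

Lemma continuous_dot (R : realType) (T : topologicalType) n
    (F G : T -> 'cV[R]_n) :
  continuous F -> continuous G -> continuous (fun t => dot (F t) (G t)).
Proof.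
move=> cF cG t.
rewrite (_ : (fun _ => _) = (fun t => \sum_i F t i ord0 * G t i ord0)); last first.
  by apply/funext => s; rewrite dotE.
apply: continuous_sum => i s; apply: cvgM.
  exact: continuous_comp (cF s) (@coord_continuous _ _ _ _ _ _).
exact: continuous_comp (cG s) (@coord_continuous _ _ _ _ _ _).
Qed.

Lemma continuous_enorm (R : realType) n : continuous (@enorm R n).
Proof.
move=> v; apply: (@continuous_comp _ _ _ (fun w => dot w w) Num.sqrt).
  by apply: (@continuous_dot R _ n id id) => w; exact: cvg_id.
exact: sqrt_continuous.
Qed.

Lemma continuous_matrix (R : realType) (T : topologicalType) m n
    (F : T -> 'M[R]_(m, n)) :
  (forall i j, continuous (fun t => F t i j)) -> continuous F.
Proof.
move=> cF t; apply/cvg_ballP => e e0.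
have near_entry : \forall s \near t, forall i j, ball (F t i j) e (F s i j).
  apply: filter_forall => i; apply: filter_forall => j.
  by have /cvg_ballP := cF i j t; apply.
by apply: filterS near_entry => s Fs; split.
Qed.

Lemma continuous_mulmx (R : realType) m n p (A : 'M[R]_(m, n)) :
  continuous (mulmx A : 'M[R]_(n, p) -> 'M[R]_(m, p)).
Proof.
apply: continuous_matrix => i j v.
rewrite (_ : (fun _ => _) = (fun w : 'M[R]_(n, p) => \sum_k A i k * w k j)).
  apply: continuous_sum => k w; apply: (@continuousM _ _ (cst (A i k))).
    exact: cst_continuous.
  exact: coord_continuous.
by apply/funext => w; rewrite mxE.
Qed.

Lemma continuous_trmx (R : realType) m n :
  continuous (@trmx R m n).
Proof.
apply: continuous_matrix => i j v.
rewrite (_ : (fun _ => _) = (fun w : 'M[R]_(m, n) => w j i)).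
  exact: coord_continuous.
by apply/funext => w; rewrite mxE.
Qed.

(** * Rayleigh quotients and extreme eigenvalues *)

(** Heine-Borel: each entry is bounded by the Euclidean norm, so the sphere is bounded in the max
    norm. The use of row vectors explains the transposes in [rayleigh_max]. *)
Lemma compact_unit_sphere (R : realType) n :
  compact [set u : 'rV[R]_n | enorm u^T = 1].
Proof.
apply: bounded_closed_compact.
  exists 1; split=> // M /ltW M_ge1 u u1; apply: le_trans M_ge1.
  rewrite /Num.norm/=; have [->//|] := eqVneq (mx_norm u) 0.
  move/mx_norm_neq0 => [[i j] ->] /=.
  rewrite -[leRHS]u1 -ler_sqr ?nnegrE ?enorm_ge0//.
  rewrite real_normK ?num_real// enorm_sqr dotE (bigD1 j)//= !mxE ord1 -expr2.
  by rewrite lerDl sumr_ge0// => k _; rewrite -expr2 sqr_ge0.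
apply: (@preimage_closed _ _ (fun u : 'rV[R]_n => enorm u^T) [set r | r = 1]).
  move=> u _; apply: continuous_comp; first exact: continuous_trmx.
  exact: continuous_enorm.
exact: closed_eq.
Qed.

(* At a maximizer [u] of the Rayleigh quotient, with value [a], the positive
   semidefinite matrix [a%:M - A] has [u] isotropic, hence in its kernel. *)
Lemma rayleigh_max (R : realType) n (A : 'M[R]_n) (v0 : 'cV[R]_n) :
  A^T = A -> v0 != 0 ->
  exists a, [/\ eigenvalue A a & forall v, dot v (A *m v) <= a * dot v v].
Proof.
move=> symA v0_neq0.
have normalize (v : 'cV[R]_n) : v != 0 -> enorm ((enorm v)^-1 *: v) = 1.
  rewrite -enorm_eq0 => v_neq0.
  by rewrite enormZ ger0_norm ?invr_ge0 ?enorm_ge0// mulVf.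
have [|u|u] := @compact_EVT_max _ R (fun u : 'rV[R]_n => dot u^T (A *m u^T))
    [set u : 'rV[R]_n | enorm u^T = 1] _ (@compact_unit_sphere R n).
- by exists ((enorm v0)^-1 *: v0)^T; rewrite /= trmxK normalize.
- apply: continuous_subspaceT; apply: continuous_dot.
    exact: continuous_trmx.
  by move=> w; apply: continuous_comp;
    [exact: continuous_trmx|exact: continuous_mulmx].
rewrite inE/= => u1 umax; set a := dot u^T (A *m u^T).
have bound v : dot v (A *m v) <= a * dot v v.
  have [->|v_neq0] := eqVneq v 0; first by rewrite mulmx0 !dot0v mulr0.
  have vv : 0 < dot v v by rewrite lt0r dot_eq0 v_neq0 dot_ge0.
  have /umax : ((enorm v)^-1 *: v)^T \in [set u : 'rV[R]_n | enorm u^T = 1].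
    by rewrite inE/= trmxK normalize.
  rewrite trmxK -/a -scalemxAr !dotS mulrA -expr2 exprVn enorm_sqr.
  by rewrite ler_pdivrMl// mulrC.
exists a; split => //.
have uu : dot u^T u^T = 1 by rewrite -enorm_sqr u1 expr1n.
have BE v : (a%:M - A) *m v = a *: v - A *m v by rewrite mulmxBl mul_scalar_mx.
have BT : (a%:M - A)^T = a%:M - A by rewrite linearB/= tr_scalar_mx symA.
have Bpsd v : 0 <= dot v ((a%:M - A) *m v).
  by rewrite BE dotBr dotZr subr_ge0.
have Bu : (a%:M - A) *m u^T = 0.
  apply/eqP; rewrite -dot_eq0 -sqrf_eq0 eq_le sqr_ge0 andbT.
  have := psd_CauchySchwarz BT Bpsd ((a%:M - A) *m u^T) u^T.
  by rewrite [in X in _ * X]BE dotBr dotZr uu mulr1 subrr mulr0.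
apply/eigenvalueP; exists u.
  move/eqP: Bu; rewrite BE subr_eq0 => /eqP /(congr1 trmx).
  by rewrite linearZ/= trmx_mul trmxK symA => <-.
apply/eqP => u0; move: uu; rewrite u0 trmx0 => /eqP.
by rewrite dot0v eq_sym oner_eq0.
Qed.

Lemma eigenvalue_rayleigh (R : realType) n (A : 'M[R]_n) a :
  A^T = A -> eigenvalue A a -> exists2 v, v != 0 & dot v (A *m v) = a * dot v v.
Proof.
move=> symA /eigenvalueP[u uA u_neq0]; exists u^T; first by rewrite trmx_eq0.
by rewrite -{1}symA -trmx_mul uA linearZ/= dotZr.
Qed.

(** The maximal Rayleigh quotient is an eigenvalue and bounds all others, so the supremum is
    attained there. The vector [v0] excludes [n = 0], where there is no eigenvalue. *)
Lemma lambda_max_eigenvalue (R : realType) n (A : 'M[R]_n) (v0 : 'cV[R]_n) :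
  A^T = A -> v0 != 0 -> eigenvalue A (lambda_max A) /\
    forall v, dot v (A *m v) <= lambda_max A * dot v v.
Proof.
move=> symA v0_neq0; have [a [eva ubA]] := rayleigh_max symA v0_neq0.
suff -> : lambda_max A = a by [].
have ub_a : ubound [set b | eigenvalue A b] a.
  move=> b /(eigenvalue_rayleigh symA)[w w_neq0 wb].
  have := ubA w; rewrite wb ler_pM2r//.
  by rewrite lt0r dot_eq0 w_neq0 dot_ge0.
apply/eqP; rewrite eq_le; apply/andP; split.
  by apply: ge_sup => //; exists a.
by apply: ub_le_sup => //; exists a.
Qed.

Lemma rayleigh_lambda_max (R : realType) n (A : 'M[R]_n) :
  A^T = A -> forall v, dot v (A *m v) <= lambda_max A * dot v v.
Proof.
move=> symA v; have [->|v_neq0] := eqVneq v 0.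
  by rewrite mulmx0 !dot0v mulr0.
by have [_] := lambda_max_eigenvalue symA v_neq0.
Qed.

(** Negation reverses the spectrum; this carries results on the largest eigenvalue over to the
    smallest. *)
Lemma lambda_maxN (R : realType) n (A : 'M[R]_n) :
  lambda_max (- A) = - lambda_min A.
Proof.
rewrite /lambda_max /lambda_min /inf opprK; congr sup.
apply/seteqP; split => [a|_ [b + <-]]/=.
  move=> /eigenvalueP[v vA v0]; exists (- a); rewrite ?opprK//.
  by apply/eigenvalueP; exists v => //; rewrite -[v *m A]opprK -mulmxN vA scaleNr.
move=> /eigenvalueP[v vA v0].
by apply/eigenvalueP; exists v => //; rewrite mulmxN vA scaleNr.
Qed.

Lemma rayleigh_lambda_min (R : realType) n (A : 'M[R]_n) :
  A^T = A -> forall v, lambda_min A * dot v v <= dot v (A *m v).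
Proof.
move=> symA v; have /(@rayleigh_lambda_max _ _ _)/(_ v) : (- A)^T = - A.
  by rewrite linearN/= symA.
by rewrite lambda_maxN mulNmx dotNr mulNr lerN2.
Qed.

(** * Positive definite matrices and their inverses *)

Lemma spd_psd (R : realType) n (P : 'M[R]_n) v : spd P -> 0 <= dot v (P *m v).
Proof.
move=> [_ pdP]; have [->|/pdP/ltW//] := eqVneq v 0.
by rewrite dot0v.
Qed.

Lemma spd_eq0 (R : realType) n (P : 'M[R]_n) v :
  spd P -> dot v (P *m v) <= 0 -> v = 0.
Proof.
by move=> [_ pdP] Pv; apply/eqP; apply: contraLR Pv => /pdP; rewrite ltNge.
Qed.

Lemma spd_unitmx (R : realType) n (P : 'M[R]_n) : spd P -> P \in unitmx.
Proof.
move=> [symP pdP]; rewrite unitmxE unitfE; apply/det0P => -[v v_neq0 vP].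
have := pdP v^T; rewrite trmx_eq0 => /(_ v_neq0).
by rewrite -{1}symP -trmx_mul vP trmx0 dotC dot0v ltxx.
Qed.

(** The smallest eigenvalue is attained, and the form is positive at its eigenvector. *)
Lemma lambda_min_gt0 (R : realType) n (P : 'M[R]_n) (v0 : 'cV[R]_n) :
  spd P -> v0 != 0 -> 0 < lambda_min P.
Proof.
move=> [symP pdP] v0_neq0.
have symN : (- P)^T = - P by rewrite linearN/= symP.
have [/(eigenvalue_rayleigh symN)[w w_neq0 +] _] :=
  lambda_max_eigenvalue symN v0_neq0.
rewrite lambda_maxN mulNmx dotNr mulNr => /oppr_inj Pw.
have := pdP _ w_neq0; rewrite Pw pmulr_lgt0//.
by rewrite lt0r dot_eq0 w_neq0 dot_ge0.
Qed.

Lemma lambda_max_gt0 (R : realType) n (P : 'M[R]_n) (v0 : 'cV[R]_n) :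
  spd P -> v0 != 0 -> 0 < lambda_max P.
Proof.
move=> [symP pdP] v0_neq0.
have := lt_le_trans (pdP _ v0_neq0) (rayleigh_lambda_max symP v0).
by rewrite pmulr_lgt0// lt0r dot_eq0 v0_neq0 dot_ge0.
Qed.

(** For [u = invmx P *m v]: [lambda_min P |u|^2 <= dot u (P *m u) = dot u v <= |u| |v|]. *)
Lemma enorm_invmx_le (R : realType) n (P : 'M[R]_n) v :
  spd P -> lambda_min P * enorm (invmx P *m v) <= enorm v.
Proof.
move=> spdP; have [symP _] := spdP; set u := invmx P *m v.
have [->|u_neq0] := eqVneq (enorm u) 0; first by rewrite mulr0 enorm_ge0.
have u_gt0 : 0 < enorm u by rewrite lt0r u_neq0 enorm_ge0.
rewrite -(ler_pM2r u_gt0) -mulrA -expr2 enorm_sqr mulrC.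
apply: le_trans (CauchySchwarz v u); apply: le_trans (ler_norm _).
rewrite mulrC (le_trans (rayleigh_lambda_min symP u))// dotC.
by rewrite mulmxA mulmxV ?mul1mx// spd_unitmx.
Qed.

(** Cauchy-Schwarz in the form of [P] for [v] and [u = invmx P *m v] gives
    [|v|^4 <= dot v (P *m v) * dot v u], and the first factor is at most [lambda_max P |v|^2]. *)
Lemma dot_invmx_ge (R : realType) n (P : 'M[R]_n) v :
  spd P -> dot v v <= lambda_max P * dot v (invmx P *m v).
Proof.
move=> spdP; have [symP _] := spdP; set u := invmx P *m v.
have [->|v_neq0] := eqVneq v 0; first by rewrite !dot0v mulr0.
have vv : 0 < dot v v by rewrite lt0r dot_eq0 v_neq0 dot_ge0.
have Pu : P *m u = v by rewrite mulmxA mulmxV ?mul1mx// spd_unitmx.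
have := psd_CauchySchwarz symP (fun w => spd_psd w spdP) v u.
rewrite Pu (dotC u) => CS; rewrite -(ler_pM2l vv) -expr2 (le_trans CS)//.
rewrite [leRHS]mulrCA mulrA ler_wpM2r// ?rayleigh_lambda_max//.
by rewrite -Pu dotC spd_psd.
Qed.

Lemma dot_invmx_gt0 (R : realType) n (P : 'M[R]_n) v :
  spd P -> v != 0 -> 0 < dot v (invmx P *m v).
Proof.
move=> spdP v_neq0; have := dot_invmx_ge v spdP.
have vv : 0 < dot v v by rewrite lt0r dot_eq0 v_neq0 dot_ge0.
by move=> /(lt_le_trans vv); rewrite pmulr_rgt0// (lambda_max_gt0 spdP v_neq0).
Qed.

(** * The correction direction: size and Lipschitz estimate *)

(* Direction of the correction term of the CBF vector field at a point where
   [grad h] is [v]. *)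
Definition cbf_dir (R : realType) n (P : 'M[R]_n) (v : 'cV[R]_n) : 'cV[R]_n :=
  (dot v (invmx P *m v))^-1 *: (invmx P *m v).

(** The numerator is at most [|v| / lambda_min P]; the denominator is at least
    [|v|^2 / lambda_max P]. *)
Lemma enorm_cbf_dir_le (R : realType) n (P : 'M[R]_n) v :
  spd P -> v != 0 ->
  enorm (cbf_dir P v) <= lambda_max P / lambda_min P / enorm v.
Proof.
move=> spdP v_neq0; have q_gt0 := dot_invmx_gt0 spdP v_neq0.
have lmin_gt0 := lambda_min_gt0 spdP v_neq0.
have v_gt0 : 0 < enorm v by rewrite lt0r enorm_eq0 v_neq0 enorm_ge0.
rewrite enormZ ger0_norm; last by rewrite invr_ge0 ltW.
rewrite ler_pdivrMl// !mulrA ler_pdivlMr// ler_pdivlMr// -mulrA mulrC -mulrA.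
apply: (@le_trans _ _ (enorm v * enorm v)).
  by rewrite ler_pM2l// enorm_invmx_le.
by rewrite -expr2 enorm_sqr mulrC dot_invmx_ge.
Qed.

(** The difference splits into a change of the vector and a change of the scalar factor, which give
    the two summands of the constant. With [d = Ldh * rho] the bound becomes [L1 * rho]. *)
Lemma cbf_dir_lipschitz (R : realType) n (P : 'M[R]_n) (g k : 'cV[R]_n)
    (eps M1 M2 M3 d : R) :
  spd P -> 0 < eps -> 0 < M1 ->
  eps <= enorm g -> M1 <= enorm k -> enorm k <= M2 -> enorm g <= M3 ->
  enorm (g - k) <= d ->
  enorm (cbf_dir P g - cbf_dir P k) <=
    lambda_max P / (lambda_min P * eps ^+ 2) *
    (1 + M2 * lambda_max P * (M2 + M3) / (lambda_min P * M1 ^+ 2)) * d.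
Proof.
move=> spdP eps_gt0 M1_gt0 g_ge k_ge k_le g_le gk_le.
have [symP _] := spdP.
have g_gt0 := lt_le_trans eps_gt0 g_ge; have k_gt0 := lt_le_trans M1_gt0 k_ge.
have g_neq0 : g != 0 by rewrite -enorm_eq0 gt_eqF.
have k_neq0 : k != 0 by rewrite -enorm_eq0 gt_eqF.
have lmin_gt0 := lambda_min_gt0 spdP g_neq0.
have lmax_gt0 := lambda_max_gt0 spdP g_neq0.
have q_gt0 := dot_invmx_gt0 spdP g_neq0.
have p_gt0 := dot_invmx_gt0 spdP k_neq0.
have enorm_inv v : enorm (invmx P *m v) <= enorm v / lambda_min P.
  by rewrite ler_pdivlMr// mulrC enorm_invmx_le.
have dot_inv v e : v != 0 -> 0 < e -> e <= enorm v ->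
    (dot v (invmx P *m v))^-1 <= lambda_max P / e ^+ 2.
  move=> v_neq0 e_gt0 ev; rewrite -[leRHS]invrK lef_pV2 ?posrE ?invr_gt0
    ?divr_gt0 ?exprn_gt0 ?dot_invmx_gt0// invf_div ler_pdivrMr//.
  rewrite mulrC (le_trans _ (dot_invmx_ge v spdP))// -enorm_sqr.
  by rewrite ler_sqr// nnegrE ?enorm_ge0// ltW.
have q_inv := dot_inv _ _ g_neq0 eps_gt0 g_ge.
have p_inv := dot_inv _ _ k_neq0 M1_gt0 k_ge.
have pq : `|dot k (invmx P *m k) - dot g (invmx P *m g)| <=
    d * ((M2 + M3) / lambda_min P).
  (* Symmetry of [invmx P] factors the difference of the quadratic forms. *)
  rewrite (_ : _ - _ = dot (k - g) (invmx P *m (k + g))); last first.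
    rewrite mulmxDr !dotS (dot_mulmx _ k g) trmx_inv symP (dotC _ g).
    by ring.
  apply: le_trans (CauchySchwarz _ _) _; rewrite -enormN opprB.
  apply: ler_pM; rewrite ?enorm_ge0//.
  apply: le_trans (enorm_inv _) _; apply: ler_wpM2r; first by rewrite invr_ge0 ltW.
  by apply: le_trans (ler_enormD _ _) _; exact: lerD.
rewrite /cbf_dir.
set q := dot g _ in q_gt0 q_inv pq *; set p := dot k _ in p_gt0 p_inv pq *.
have -> : q^-1 *: (invmx P *m g) - p^-1 *: (invmx P *m k) =
    q^-1 *: (invmx P *m (g - k)) + ((p - q) * (q^-1 * p^-1)) *: (invmx P *m k).
  rewrite mulmxBr scalerBr -addrA -!scaleNr -scalerDl; congr (_ + _ *: _).
  by field; rewrite !gt_eqF.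
apply: le_trans (ler_enormD _ _) _; rewrite !enormZ ger0_norm;
  last by rewrite invr_ge0 ltW.
rewrite normrM [`|q^-1 * _|]ger0_norm; last by rewrite ltW// mulr_gt0 ?invr_gt0.
set lmin := lambda_min P in lmin_gt0 pq enorm_inv *.
set lmax := lambda_max P in lmax_gt0 q_inv p_inv *.
(* The bound is regrouped so that its summands dominate the two terms factor by factor. *)
have -> : lmax / (lmin * eps ^+ 2) *
    (1 + M2 * lmax * (M2 + M3) / (lmin * M1 ^+ 2)) * d =
  (lmax / eps ^+ 2) * (d / lmin) +
  (d * ((M2 + M3) / lmin)) * ((lmax / eps ^+ 2) * (lmax / M1 ^+ 2)) * (M2 / lmin).
  by field; rewrite !gt_eqF.
have q_ge0 : 0 <= q^-1 by rewrite invr_ge0 ltW.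
have p_ge0 : 0 <= p^-1 by rewrite invr_ge0 ltW.
apply: lerD.
  apply: ler_pM; rewrite ?enorm_ge0//; apply: le_trans (enorm_inv _) _.
  by rewrite ler_pM2r ?invr_gt0.
apply: ler_pM; rewrite ?mulr_ge0 ?enorm_ge0//.
  by apply: ler_pM; rewrite ?mulr_ge0// ler_pM.
by apply: le_trans (enorm_inv _) _; rewrite ler_pM2r ?invr_gt0.
Qed.

(** * Explicit form of the constrained minimizer *)

(* Strong convexity of [mu |-> |mu - f|_P^2]: [s >= 0] is the KKT multiplier. *)
Lemma f_cbf_kkt (R : realType) m n (P : 'M[R]_n)
    (f : 'cV[R]_m * 'cV[R]_n -> 'cV[R]_n) (h : 'cV[R]_n -> R) alpha w s :
  spd P -> 0 <= s ->
  let mu := f w + s *: (invmx P *m grad h w.2) in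
  cbf_feasible h alpha w.2 mu ->
  s * (dot (grad h w.2) mu + alpha * h w.2) = 0 ->
  f_cbf P f h alpha w = mu.
Proof.
move=> spdP s_ge0 mu mu_feas mu_compl; set g := grad h w.2 in mu mu_feas mu_compl *.
have [symP _] := spdP.
have pnorm_sqr v : pnorm P v ^+ 2 = dot v (P *m v) by rewrite sqr_sqrtr ?spd_psd.
have pyth nu : cbf_feasible h alpha w.2 nu ->
    pnorm P (mu - f w) ^+ 2 + dot (nu - mu) (P *m (nu - mu)) <=
    pnorm P (nu - f w) ^+ 2.
  rewrite /cbf_feasible/= -/g !pnorm_sqr => nu_feas.
  (* Stationarity in the KKT conditions. *)
  have Pmu : P *m (mu - f w) = s *: g.
    rewrite /mu addrC addKr -scalemxAr mulmxA mulmxV ?mul1mx//.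
    exact: spd_unitmx.
  rewrite (_ : nu - f w = (nu - mu) + (mu - f w)); last by rewrite addrA subrK.
  have [a aE] : exists a, a = nu - mu by exists (nu - mu).
  rewrite -aE; move: (mu - f w) Pmu => b Pmu.
  rewrite mulmxDr !dotDr !dotDl [dot b (P *m a)]dot_mulmx symP.
  rewrite Pmu dotZl !dotZr (dotC a g) aE dotBr.
  (* The cross term is twice [s * dot g (nu - mu)]; feasibility of [nu] and complementary slackness
     at [mu] make it nonnegative. *)
  have := mulr_ge0 s_ge0 nu_feas; rewrite mulrDr.
  by move: mu_compl; rewrite mulrDr; lra.
apply: xget_unique => [|nu [nu_feas nu_min]].
  split => // nu /pyth; apply: le_trans; rewrite lerDl.
  exact: spd_psd.
(* For another minimizer [nu], the excess term in [pyth] is at most 0. *)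
apply/eqP; rewrite -subr_eq0; apply/eqP/(spd_eq0 spdP).
have := pyth _ nu_feas; have := nu_min _ mu_feas; lra.
Qed.

(** * Gradients, tangent directions and the boundary *)

Lemma locally_lipschitz_continuous (R : realType) (V W : normedModType R)
    (F : V -> W) : locally_lipschitz F -> continuous F.
Proof.
move=> lipF x; have [U Ux lipU] := lipF x.
near (pinfty_nbhs R) => k.
have k_gt0 : 0 < k by near: k; exact: nbhs_pinfty_gt.
have lipk : k.-lipschitz_U F by near: k.
apply/cvgrPdist_le => e e0; near=> y.
have Uy : U y by near: y.
have Ux' : U x := nbhs_singleton Ux.
have /= lipxy := lipk (x, y) (conj Ux' Uy).
apply: le_trans lipxy _; rewrite -ler_pdivlMl// mulrC.
near: y; apply: (@cvgr_dist_le _ _ _ (nbhs x) _ id x) => //.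
by rewrite divr_gt0.
Unshelve. all: by end_near. Qed.

Lemma diff_dot_grad (R : realType) n (h : 'cV[R]_n -> R) x v :
  differentiable h x -> 'd h x v = dot (grad h x) v.
Proof.
move=> dh; rewrite dotE {1}(matrix_sum_delta v) linear_sum/=.
apply: eq_bigr => i _; rewrite linear_sum/= big_ord1 linearZ/= mxE.
by rewrite deriveE// mulrC.
Qed.

(** The directions vary with [k], as in the Bouligand cone: the remainder is [o(t k * |u k|)] and
    [u k] stays bounded. *)
Lemma cvg_difference_quotient (R : realType) n (h : 'cV[R]_n -> R) y v
    (t : nat -> R) (u : nat -> 'cV[R]_n) :
  differentiable h y -> (forall k, 0 < t k) ->
  t k @[k --> \oo] --> (0 : R) -> u k @[k --> \oo] --> v ->
  (t k)^-1 * (h (y + t k *: u k) - h y) @[k --> \oo] --> dot (grad h y) v.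
Proof.
move=> dh t_gt0 t0 uv.
have tu0 : t k *: u k @[k --> \oo] --> (0 : 'cV[R]_n).
  by rewrite -(scale0r v); exact: cvgZ.
have du : 'd h y (u k) @[k --> \oo] --> 'd h y v.
  by apply: continuous_cvg uv; exact: diff_continuous.
rewrite -diff_dot_grad//; apply/cvgrPdist_le => e e_gt0.
(* Eventually [|u k| <= |v| + 1], so this tolerance leaves [e / 2] for the remainder. *)
have e'_gt0 : 0 < e / 2 / (`|v| + 1) by rewrite !divr_gt0// ltr_wpDl.
have /eqaddoP/(_ _ e'_gt0) small := diff_locally dh.
near=> k.
have hk : `|h (y + t k *: u k) - h y - 'd h y (t k *: u k)| <=
    e / 2 / (`|v| + 1) * (t k * `|u k|).
  rewrite -{3}(gtr0_norm (t_gt0 k)) -normrZ (addrC y) -addrA -opprD.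
  by near: k; exact: tu0 small.
have -> : (t k)^-1 * (h (y + t k *: u k) - h y) =
    'd h y (u k) + (t k)^-1 * (h (y + t k *: u k) - h y - 'd h y (t k *: u k)).
  rewrite linearZ/= -[t k *: 'd h y (u k)]/(t k * 'd h y (u k)) [in RHS]mulrBr.
  by rewrite mulKf ?gt_eqF// [RHS]addrC subrK.
rewrite opprD addrA (splitr e); apply: le_trans (ler_normB _ _) _; apply: lerD.
  by near: k; move/cvgrPdist_le : du; apply; rewrite divr_gt0.
rewrite normrM ger0_norm; last by rewrite invr_ge0 ltW.
rewrite ler_pdivrMl// (le_trans hk)//.
rewrite mulrCA ler_pM2l//.
rewrite -[leLHS]mulrA ger_pMr ?divr_gt0// ler_pdivrMl ?ltr_wpDl// mulr1.
by near: k; apply: cvgr_norm_le uv _ _; rewrite ltrDl.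
Unshelve. all: by end_near. Qed.

(** Along a tangent sequence [h] is nonnegative while [h y = 0], so in the limit
    [0 <= dot (grad h y) v]. *)
Lemma normal_cone_grad (R : realType) n (h : 'cV[R]_n -> R) y (a : R) :
  differentiable h y -> h y = 0 -> a <= 0 ->
  normal_cone [set x | 0 <= h x] y (a *: grad h y).
Proof.
move=> dh hy0 a_le0 v [t [u [t_gt0 t0 uv tuS]]].
rewrite dotZl mulr_le0_ge0//.
apply: (cvgr_to_ge (cvg_difference_quotient dh t_gt0 t0 uv)).
near=> k; rewrite hy0 subr0 mulr_ge0//; last exact: tuS.
by rewrite invr_ge0 ltW.
Unshelve. all: by end_near. Qed.

(** At a maximum the difference quotients in the direction [grad h x] are nonpositive, and they tend
    to [|grad h x|^2]. *)
Lemma grad_max_eq0 (R : realType) n (h : 'cV[R]_n -> R) x :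
  differentiable h x -> (forall y, h y <= h x) -> grad h x = 0.
Proof.
move=> dh hmax; apply/eqP; rewrite -dot_eq0 eq_le dot_ge0 andbT.
apply: (cvgr_to_le (cvg_difference_quotient dh (@harmonic_gt0 R)
  (@cvg_harmonic R) (@cvg_cst _ (grad h x) _ \oo _))).
by near=> k; rewrite /= mulr_ge0_le0 ?invr_ge0 ?subr_le0.
Unshelve. all: by end_near. Qed.

Lemma boundary_superlevel (R : realType) (T : topologicalType) (h : T -> R) y :
  continuous h -> boundary [set x | 0 <= h x] y -> h y = 0.
Proof.
move=> ch [clS nintS]; apply/eqP; rewrite eq_le; apply/andP; split.
  rewrite leNgt; apply/negP => hy_gt0; apply: nintS.
  rewrite /interior/=; near=> x; apply: ltW; near: x.
  exact: (cvgr_gt (h y) (ch y)).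
by apply: (@preimage_closed _ _ h [set r | 0 <= r] _ (@closed_ge R 0)) clS.
Unshelve. all: by end_near. Qed.

(** A [sup] is an upper bound only for a bounded set; boundedness is obtained here from
    compactness. *)
Lemma compact_has_ubound_image (R : realType) (T : topologicalType)
    (A : set T) (F : T -> R) :
  compact A -> continuous F -> has_ubound [set F x | x in A].
Proof.
move=> cA cF; have [->|A0] := eqVneq A set0.
  by exists 0 => _ [x []].
have [||c _ cmax] := @compact_EVT_max T R F A _ cA.
- exact/set0P.
- exact: continuous_subspaceT.
- by exists (F c) => _ [x Ax <-]; apply: cmax; rewrite inE.
Qed.

(** * Class K-infinity functions and a critical point of [h] *)

Lemma Kinfty_homo (R : realType) (gamma : R -> R) a b :
  class_Kinfty gamma -> 0 <= a -> a <= b -> gamma a <= gamma b.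
Proof.
move=> [_ mono _ _] a0; rewrite le_eqVlt => /predU1P[->//|ab].
by apply/ltW/mono => //; rewrite in_itv/= andbT// (le_trans a0)// ltW.
Qed.

Lemma Kinfty_ge0 (R : realType) (gamma : R -> R) a :
  class_Kinfty gamma -> 0 <= a -> 0 <= gamma a.
Proof.
by move=> Kg a0; have [_ _ <- _] := Kg; exact: Kinfty_homo.
Qed.

(** The intermediate value theorem gives a preimage of [r], injectivity makes it the value of
    [Kinv], and [gamma 0 = 0 < r] makes it positive. *)
Lemma Kinfty_KinvK (R : realType) (gamma : R -> R) r :
  class_Kinfty gamma -> 0 < r -> 0 < Kinv gamma r /\ gamma (Kinv gamma r) = r.
Proof.
move=> [cg mono g0 ginfty] r_gt0.
have [c c_ge0 gc] : exists2 c, 0 <= c & gamma c = r.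
  near (pinfty_nbhs R) => b.
  have b_ge0 : 0 <= b by near: b; exact: nbhs_pinfty_ge.
  have rb : r <= gamma b.
    by near: b; move/cvgryPge : ginfty; apply.
  have [||c cb gc] := @IVT R gamma 0 b r b_ge0.
  - apply: continuous_subspaceW cg => x /=; rewrite !in_itv/=.
    by case/andP => ->.
  - by rewrite g0 ge_min (ltW r_gt0)//= le_max rb orbT.
  - by exists c => //; move: cb; rewrite in_itv/= => /andP[].
have ginj : {in `[0, +oo[%classic &, injective gamma}.
  move=> a b; rewrite !inE => a0 b0; apply: contra_eq.
  by rewrite neq_lt => /orP[] /mono => [/(_ a0 b0)|/(_ b0 a0)] /lt_eqF => [|+ ];
    rewrite 1?eq_sym => ->.
have -> : Kinv gamma r = c.
  by rewrite /Kinv -gc pinvKV// inE/= in_itv/= c_ge0.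
split => //; rewrite lt0r c_ge0 andbT; apply/eqP => c0.
by move: r_gt0; rewrite -gc c0 g0 ltxx.
Unshelve. all: by end_near. Qed.

(** A maximum of [h] on [S] is global, since [h < 0] outside [S]. Comparing this point with a
    boundary point later yields [0 < Ldh] and [0 <= Lf]. *)
Lemma superlevel_critical_point (R : realType) n (h : 'cV[R]_n -> R) :
  let S := [set x | 0 <= h x] in
  S !=set0 -> compact S -> (forall x, differentiable h x) ->
  exists2 c, S c & grad h c = 0.
Proof.
move=> S S0 cptS dh.
have ch : continuous h by move=> x; exact: differentiable_continuous.
have [|c] := @compact_EVT_max _ R h S S0 cptS; first exact: continuous_subspaceT.
rewrite inE => Sc cmax; exists c => //.
apply: grad_max_eq0 => // y; have [Sy|/ltW hy] := leP 0 (h y).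
  by apply: cmax; rewrite inE.
exact: le_trans hy Sc.
Qed.

(** * Inclusion for the CBF-based vector field *)

(* When alpha_s = 0, the Lie derivative vanishes on Z `*` S and alpha_s^-1 = 0,
   so alpha_s^-1 * `|Lfh w| is 0, as it should be by convention. *)
Theorem mainTheorem3 (R : realType) (m n : nat)
    (h : 'cV[R]_n -> R) (Ldh : R) (gamma : R -> R) (P : 'M[R]_n)
    (f : 'cV[R]_m * 'cV[R]_n -> 'cV[R]_n) (Z : set 'cV[R]_m) (Lf eps : R) :
  let S := [set x | 0 <= h x] in
  let bS := boundary S in
  let Lfh := lie f h in
  let lmin := lambda_min P in
  let lmax := lambda_max P in
  let M1 := inf [set enorm (grad h y) | y in bS] in
  let M2 := sup [set enorm (grad h y) | y in bS] in
  let maxLfh := sup [set `|Lfh w| | w in Z `*` S] in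
  let alpha_s := maxLfh / Kinv gamma ((M1 - eps) / Ldh) in
  let M3 := M2 + Ldh * gamma (alpha_s^-1 * maxLfh) in
  let L1 := lmax / (lmin * eps ^+ 2) * Ldh *
              (1 + M2 * lmax * (M2 + M3) / (lmin * M1 ^+ 2)) in
  let sigma (alpha : R) :=
    sup [set Num.max (gamma (alpha^-1 * `|Lfh w|))
               ((Lf + L1 * `|Lfh w|) * gamma (alpha^-1 * `|Lfh w|))
        | w in Z `*` S] in
  let delta :=
    sup [set (1 + Ldh * gamma (alpha_s^-1 * `|Lfh w|) / M1) *
               (lmax / lmin) * enorm (f w)
        | w in Z `*` S] in
  S !=set0 -> compact S ->
  C1 h -> locally_lipschitz (grad h) ->
  lipschitz_const (@eucl_dist R n) S (grad h) Ldh ->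
  (forall x, h x = 0 -> grad h x != 0) ->
  class_Kinfty gamma ->
  (forall x, S x -> dist_set x bS <= gamma (h x)) ->
  spd P ->
  locally_lipschitz f ->
  compact Z ->
  lipschitz_const (@eucl_dist_prod R m n) (Z `*` S) f Lf ->
  0 < eps -> eps < M1 ->
  forall alpha : R, alpha_s <= alpha -> 0 < alpha ->
  forall (z : 'cV[R]_m) (x : 'cV[R]_n), Z z -> S x ->
  (\bigcup_(y in minkowski_sum [set x] (scale_set (sigma alpha) unit_ball) `&` S)
     minkowski_sum (normal_coneP P S y (f (z, y)) delta)
                   (scale_set (sigma alpha) unit_ball))
    (f_cbf P f h alpha (z, x)).
Proof.
move=> S bS Lfh lmin lmax M1 M2 maxLfh alpha_s M3 L1 sigma delta S0 cptS.
move=> [dh cgrad] lipgrad lipS gradN0 Kg dist_le spdP lipf cptZ lipfZS.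
move=> eps_gt0 eps_lt alpha alpha_ge alpha_gt0 z x Zz Sx.

(* Continuity, compactness and signs of the constants *)
have ch : continuous h by move=> y; exact: differentiable_continuous.
have cf : continuous f := locally_lipschitz_continuous lipf.
have cLfh : continuous Lfh.
  apply: continuous_dot cf => w; apply: continuous_comp; first exact: cvg_snd.
  exact: cgrad.
have cptZS : compact (Z `*` S) := compact_setX cptZ cptS.
have ZSzx : (Z `*` S) (z, x) by [].
have M1_gt0 : 0 < M1 := lt_trans eps_gt0 eps_lt.
have bSE y : bS y -> h y = 0 := boundary_superlevel ch.
have bSS y : bS y -> S y by rewrite /S/= => /bSE ->.
have M1_le y : bS y -> M1 <= enorm (grad h y).
  move=> bSy; apply: ge_inf; last by exists y.
  by exists 0 => _ [u _ <-]; exact: enorm_ge0.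
have le_M2 y : bS y -> enorm (grad h y) <= M2.
  move=> bSy; apply: ub_le_sup; last by exists y.
  have [A ubA] : has_ubound [set enorm (grad h u) | u in S].
    apply: compact_has_ubound_image => // u.
    by apply: continuous_comp; [exact: cgrad|exact: continuous_enorm].
  by exists A => _ [u bSu <-]; apply: ubA; exists u => //; exact: bSS.
(* The infimum of the empty set is 0, which contradicts [0 < M1]. *)
have [b bSb] : bS !=set0.
  apply/set0P/eqP => bS0; move: M1_gt0.
  by rewrite /M1 bS0 image_set0 inf0 ltxx.
have [c Sc gc0] := superlevel_critical_point S0 cptS dh.
have gb_gt0 : 0 < enorm (grad h b) := lt_le_trans M1_gt0 (M1_le _ bSb).
have gbN0 : grad h b != 0 by rewrite -enorm_eq0 gt_eqF.
have lmin_gt0 : 0 < lmin := lambda_min_gt0 spdP gbN0.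
have lmax_gt0 : 0 < lmax := lambda_max_gt0 spdP gbN0.
have bc_gt0 : 0 < enorm (b - c).
  rewrite lt0r enorm_ge0 andbT enorm_eq0 subr_eq0.
  by apply: contraNneq gbN0 => ->; rewrite gc0.
have Ldh_gt0 : 0 < Ldh.
  have := lipS _ _ (bSS _ bSb) Sc; rewrite /eucl_dist gc0 subr0.
  by move=> /(lt_le_trans gb_gt0); rewrite pmulr_lgt0.
have lip_fz u v : S u -> S v -> enorm (f (z, u) - f (z, v)) <= Lf * enorm (u - v).
  move=> Su Sv; have := lipfZS (z, u) (z, v) (conj Zz Su) (conj Zz Sv).
  rewrite /eucl_dist_prod /eucl_dist/= subrr enorm0 expr0n add0r.
  by rewrite sqrtr_sqr ger0_norm ?enorm_ge0.
have Lf_ge0 : 0 <= Lf.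
  have := lip_fz _ _ (bSS _ bSb) Sc.
  by move=> /(le_trans (enorm_ge0 _)); rewrite pmulr_lge0.
have Lfh_le w : (Z `*` S) w -> `|Lfh w| <= maxLfh.
  move=> ZSw; apply: ub_le_sup; last by exists w.
  apply: compact_has_ubound_image => // u.
  by apply: continuous_comp; [exact: cLfh|exact: norm_continuous].
have maxLfh_ge0 : 0 <= maxLfh := le_trans (normr_ge0 _) (Lfh_le _ ZSzx).
have [K_gt0 KE] : 0 < Kinv gamma ((M1 - eps) / Ldh) /\
    gamma (Kinv gamma ((M1 - eps) / Ldh)) = (M1 - eps) / Ldh.
  by apply: Kinfty_KinvK => //; rewrite divr_gt0 ?subr_gt0.
have alpha_s_ge0 : 0 <= alpha_s by rewrite divr_ge0// ltW.
have gamma_le a w : 0 <= a -> (Z `*` S) w ->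
    gamma (a * `|Lfh w|) <= gamma (a * maxLfh).
  move=> a_ge0 ZSw; apply: Kinfty_homo => //; first by rewrite mulr_ge0.
  by rewrite ler_wpM2l// Lfh_le.
have gamma_ge0 a w : 0 <= a -> 0 <= gamma (a * `|Lfh w|).
  by move=> a_ge0; apply: Kinfty_ge0 => //; rewrite mulr_ge0.

(* Lower bounds for [sigma alpha] and [delta] at [(z, x)] *)
set rho := gamma (alpha^-1 * `|Lfh (z, x)|).
have rho_ge0 : 0 <= rho by apply: gamma_ge0; rewrite invr_ge0 ltW.
have sigma_ge : Num.max rho ((Lf + L1 * `|Lfh (z, x)|) * rho) <= sigma alpha.
  apply: ub_le_sup; last by exists (z, x).
  (* An upper bound showing that the supremum is finite; [|L1|] makes it valid whatever the sign of
     [L1]. *)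
  exists (Num.max (gamma (alpha^-1 * maxLfh))
    ((Lf + `|L1| * maxLfh) * gamma (alpha^-1 * maxLfh))).
  move=> _ [w ZSw <-].
  have ia_ge0 : 0 <= alpha^-1 by rewrite invr_ge0 ltW.
  rewrite ge_max !le_max gamma_le//=; apply/orP; right.
  apply: le_trans (_ : (Lf + `|L1| * `|Lfh w|) * gamma (alpha^-1 * `|Lfh w|) <= _).
    by rewrite ler_wpM2r ?gamma_ge0// lerD2l ler_wpM2r// ler_norm.
  apply: ler_pM; rewrite ?gamma_ge0 ?gamma_le//.
    by rewrite addr_ge0 ?mulr_ge0.
  by rewrite lerD2l ler_wpM2l// Lfh_le.
have [rho_le LL_le] : rho <= sigma alpha /\
    (Lf + L1 * `|Lfh (z, x)|) * rho <= sigma alpha.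
  by move: sigma_ge; rewrite ge_max => /andP[].
have sigma_ge0 : 0 <= sigma alpha := le_trans rho_ge0 rho_le.
have coef_ge0 w : 0 <= 1 + Ldh * gamma (alpha_s^-1 * `|Lfh w|) / M1.
  by rewrite addr_ge0 ?divr_ge0 ?mulr_ge0 ?gamma_ge0 ?invr_ge0// ltW.
have delta_ge : (1 + Ldh * gamma (alpha_s^-1 * `|Lfh (z, x)|) / M1) *
    (lmax / lmin) * enorm (f (z, x)) <= delta.
  apply: ub_le_sup; last by exists (z, x).
  have [F ubF] : has_ubound [set enorm (f w) | w in Z `*` S].
    apply: compact_has_ubound_image => // u.
    by apply: continuous_comp; [exact: cf|exact: continuous_enorm].
  exists ((1 + Ldh * gamma (alpha_s^-1 * maxLfh) / M1) * (lmax / lmin) * F).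
  move=> _ [w ZSw <-]; apply: ler_pM; rewrite ?enorm_ge0//.
  - by rewrite mulr_ge0// divr_ge0// ltW.
  - rewrite ler_pM2r ?divr_gt0// lerD2l ler_pM2r ?invr_gt0// ler_pM2l//.
    by rewrite gamma_le ?invr_ge0.
  - by apply: ubF; exists w.
have delta_ge0 : 0 <= delta.
  by apply: le_trans delta_ge; rewrite !mulr_ge0 ?enorm_ge0 ?invr_ge0// ltW.
clearbody sigma delta M1 M2 maxLfh.

(* Inactive constraint *)
have [feas|infeas] := leP 0 (Lfh (z, x) + alpha * h x).
  have -> : f_cbf P f h alpha (z, x) = f (z, x).
    rewrite (@f_cbf_kkt _ _ _ P f h alpha (z, x) 0)// ?scale0r ?addr0//.
    by rewrite mul0r.
  exists x => /=.
    split => //; exists x => //; exists 0; last by rewrite addr0.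
    by apply: mem_scale_unit_ball; rewrite enorm0.
  exists (f (z, x)); last first.
    by exists 0; [apply: mem_scale_unit_ball; rewrite enorm0|rewrite addr0].
  exists 0; last by rewrite subr0.
  split; last by apply: mem_scale_unit_ball; rewrite enorm0.
  by exists 0; [move=> v _; rewrite dot0v|rewrite mulmx0].

(* Active constraint: a nearby boundary point *)
have hx_ge0 : 0 <= h x := Sx.
have Lzx_lt0 : Lfh (z, x) < 0.
  by apply: le_lt_trans infeas; rewrite lerDl mulr_ge0// ltW.
have normL : `|Lfh (z, x)| = - Lfh (z, x) by rewrite ltr0_norm.
(* Activity excludes the degenerate case [alpha_s = 0], so [alpha_s <= alpha] can be inverted. *)
have maxLfh_gt0 : 0 < maxLfh.
  by apply: lt_le_trans (Lfh_le _ ZSzx); rewrite normL oppr_gt0.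
have alpha_s_gt0 : 0 < alpha_s by rewrite divr_gt0.
have ialpha_le : alpha^-1 <= alpha_s^-1 by rewrite lef_pV2 ?posrE.
have ialpha_ge0 : 0 <= alpha^-1 by rewrite invr_ge0 ltW.
have rho_le_s : rho <= gamma (alpha_s^-1 * `|Lfh (z, x)|).
  by apply: Kinfty_homo => //; rewrite ?mulr_ge0 ?ler_wpM2r.
have rho_le_max : rho <= gamma (alpha_s^-1 * maxLfh).
  by apply: le_trans rho_le_s _; rewrite gamma_le ?invr_ge0.
(* By definition of [alpha_s], [alpha_s^-1 * maxLfh] is [Kinv gamma ((M1 - eps) / Ldh)]. *)
have rho_le_M1 : rho <= (M1 - eps) / Ldh.
  rewrite -KE; apply: le_trans rho_le_max _; rewrite /alpha_s invf_div divfK//.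
  by rewrite gt_eqF.
(* Since [alpha * h x < - Lfh (z, x)], the distance is strictly below [rho], so [y] is found without
   attaining the infimum. *)
have [y bSy xy_lt] : exists2 y, bS y & enorm (x - y) < rho.
  have [||_ [y bSy <-] xy] := @inf_lt R [set eucl_dist x y | y in bS] rho.
  - by exists (eucl_dist x b), b.
  - apply: le_lt_trans (dist_le _ Sx) _.
    have [_ mono _ _] := Kg; apply: mono; rewrite ?in_itv/= ?andbT ?mulr_ge0//.
    by rewrite ltr_pdivlMl// normL; move: infeas; clear; lra.
  - by exists y.
set g := grad h x; set k := grad h y.
have k_ge : M1 <= enorm k := M1_le _ bSy.
have gk_le : enorm (g - k) <= Ldh * enorm (x - y) := lipS _ _ Sx (bSS _ bSy).
have gk_le_rho : enorm (g - k) <= Ldh * rho.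
  by apply: le_trans gk_le _; rewrite ler_pM2l// ltW.
have g_le : enorm g <= enorm k + Ldh * rho.
  rewrite -{1}(subrK k g) addrC; apply: le_trans (ler_enormD _ _) _.
  by rewrite lerD2l.
(* [|g| >= |k| - Ldh * rho >= M1 - (M1 - eps) = eps]. *)
have g_ge : eps <= enorm g.
  have : enorm k <= enorm g + Ldh * rho.
    rewrite -{1}(subKr g k); apply: le_trans (ler_enormB _ _) _.
    by rewrite lerD2l.
  move: k_ge rho_le_M1; rewrite (ler_pdivlMr _ _ Ldh_gt0) (mulrC rho); clear.
  lra.
have g_gt0 := lt_le_trans eps_gt0 g_ge; have k_gt0 := lt_le_trans M1_gt0 k_ge.
have gN0 : g != 0 by rewrite -enorm_eq0 (lt0r_neq0 g_gt0).
have kN0 : k != 0 by rewrite -enorm_eq0 (lt0r_neq0 k_gt0).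
have q_gt0 := dot_invmx_gt0 spdP gN0; have p_gt0 := dot_invmx_gt0 spdP kN0.
set s := - (Lfh (z, x) + alpha * h x).
have s_gt0 : 0 < s by rewrite oppr_gt0.
have s_le : s <= `|Lfh (z, x)|.
  by rewrite normL lerN2 lerDl mulr_ge0// ltW.
(* The multiplier [s / dot g (invmx P *m g)] makes the constraint an equality, which gives both
   feasibility and complementarity. *)
have fcbfE : f_cbf P f h alpha (z, x) = f (z, x) + s *: cbf_dir P g.
  have active : dot g (f (z, x) + s *: cbf_dir P g) + alpha * h x = 0.
    rewrite /cbf_dir !dotS mulVf ?gt_eqF// mulr1 /s /Lfh /lie/= -/g.
    by ring.
  rewrite /cbf_dir scalerA.
  rewrite (@f_cbf_kkt _ _ _ P f h alpha (z, x) (s / dot g (invmx P *m g)))//.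
  - exact: divr_ge0 (ltW s_gt0) (ltW q_gt0).
  - by rewrite /cbf_feasible/= -/g -scalerA -/(cbf_dir P g) active.
  - by rewrite /= -/g -scalerA -/(cbf_dir P g) active mulr0.

(* Normal vector at [y] and the residual *)
rewrite fcbfE; exists y.
  split; last exact: bSS.
  exists x => //; exists (y - x); last by rewrite addrC subrK.
  apply: mem_scale_unit_ball; rewrite -enormN opprB.
  by apply: le_trans rho_le; exact: ltW.
exists (f (z, y) + s *: cbf_dir P k).
  exists (- (s *: cbf_dir P k)); last (rewrite opprK; reflexivity).
  split.
    exists ((- (s / dot k (invmx P *m k))) *: k).
      apply: normal_cone_grad => //; first exact: bSE.
      rewrite oppr_le0; exact: divr_ge0 (ltW s_gt0) (ltW p_gt0).
    by rewrite /cbf_dir -scalemxAr scalerA scaleNr.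
  apply: mem_scale_unit_ball; apply: le_trans delta_ge.
  rewrite enormN enormZ gtr0_norm//.
  (* The factors bound [s <= |Lfh (z, x)| <= |g| |f (z, x)|] and the norm of the direction at
     [k]. *)
  apply: (@le_trans _ _ ((enorm g * enorm (f (z, x))) *
      (lmax / lmin / enorm k))).
    apply: ler_pM; rewrite ?enorm_ge0 ?(ltW s_gt0) ?enorm_cbf_dir_le//.
    by apply: le_trans s_le _; exact: CauchySchwarz.
  rewrite (_ : _ * _ * _ = enorm g / enorm k * (lmax / lmin) * enorm (f (z, x)));
    last by ring.
  rewrite ler_wpM2r ?enorm_ge0// ler_pM2r ?divr_gt0//.
  (* The ratio [|g| / |k|] is bounded by the first factor of [delta], from [|g| <= |k| + Ldh * rho]
     and [M1 <= |k|]. *)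
  rewrite ler_pdivrMr// mulrDl mul1r; apply: le_trans g_le _; rewrite lerD2l.
  rewrite mulrAC -mulrA.
  apply: (@le_trans _ _ (Ldh * gamma (alpha_s^-1 * `|Lfh (z, x)|))).
    by rewrite ler_pM2l.
  rewrite -[leRHS]mulrA ler_pM2l// ler_peMr ?gamma_ge0 ?invr_ge0//.
  rewrite (ler_pdivlMr _ _ M1_gt0) mul1r; exact: k_ge.
(* The change of [f] costs at most [Lf * rho], the change of direction at most
   [|Lfh (z, x)| * L1 * rho]. *)
exists (f (z, x) - f (z, y) + s *: (cbf_dir P g - cbf_dir P k)); last first.
  by rewrite scalerBr addrACA subrKC subrKC.
apply: mem_scale_unit_ball; apply: le_trans LL_le.
apply: le_trans (ler_enormD _ _) _; rewrite mulrDl; apply: lerD.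
  apply: le_trans (lip_fz _ _ Sx (bSS _ bSy)) _.
  by rewrite ler_wpM2l// ltW.
rewrite enormZ gtr0_norm// mulrAC mulrC.
apply: ler_pM; rewrite ?enorm_ge0// ?(ltW s_gt0)//.
have g_le_M3 : enorm g <= M3.
  apply: le_trans g_le _; apply: lerD; first exact: le_M2.
  by rewrite ler_pM2l.
(* The factor [Ldh] of [L1] is moved next to [rho] to form [d = Ldh * rho]. *)
rewrite /L1 [X in _ <= X * rho]mulrAC -[leRHS]mulrA.
exact: cbf_dir_lipschitz (le_M2 _ bSy) g_le_M3 gk_le_rho.
Qed.
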